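(* There is a pseudopolynomial time algorithm that decides ALL-AGENTS-SAT$(m-1)$ under the condition that each agent has total demand exactly $1$, i.e. restricted to instances with $\sum_{j=1}^m d^i_j=1$ for every agent $i$.
   Context: An instance with $n$ agents and $m$ projects consists of rational demands $d^i_j\in[0,1]$ for $i\in[n]=\{1,\dots,n\}$ and $j\in[m]$. A solution is a vector $\mathbf{x}\in[0,1]^m$; it is budget-feasible if $\sum_{j=1}^m x_j\le 1$. Given a threshold $\tau$, agent $i$ is satisfied by $\mathbf{x}$ if the number of projects $j\in[m]$ with $x_j\ge d^i_j$ is at least $\tau$. The problem ALL-AGENTS-SAT$(\tau)$: given the agents' demands, decide whether there exists a budget-feasible solution satisfying all agents. Here $\tau=m-1$, where $m$ is the number of projects of the input instance. Pseudopolynomial time means time polynomial in the input length when all numbers (numerators and denominators) in the input are encoded in unary. *)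

(* Defs.v *)
From HB Require Import structures.
From mathcomp Require Import all_boot all_order all_algebra reals.

Set Implicit Arguments.
Unset Strict Implicit.
Unset Printing Implicit Defensive.

Import Order.TTheory GRing.Theory Num.Theory.

(* Algorithms are programs of a deterministic random access machine with a
   one-way read-only input tape over {0,1}, addition, truncated subtraction
   and indirect addressing. Running time is measured by the logarithmic cost
   criterion, so that polynomial time on this machine coincides with
   polynomial time on Turing machines. *)

Inductive instr : Type :=
| Iconst of nat & nat        (* Iconst r c  : R[r] := c *)
| Iadd of nat & nat & nat    (* Iadd r s t  : R[r] := R[s] + R[t] *)
| Isub of nat & nat & nat    (* Isub r s t  : R[r] := R[s] - R[t], truncated *)
| Ifetch of nat & nat        (* Ifetch r s  : R[r] := R[R[s]] *)
| Istore of nat & nat        (* Istore r s  : R[R[r]] := R[s] *)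
| Ijpos of nat & nat         (* Ijpos r l   : if R[r] > 0 then go to l *)
| Iread of nat.              (* Iread r     : R[r] := next input symbol *)

Definition program := seq instr.

Record config := Config {
  pc : nat;
  tape : seq bool;           (* the part of the input not read yet *)
  regs : nat -> nat
}.

Definition init_config (w : seq bool) : config := Config 0 w (fun=> 0).

(* Iread distinguishes the end of the input (0) from the symbols 0 and 1,
   which are read as 1 and 2. *)
Definition next_symbol (w : seq bool) : nat :=
  if w is b :: _ then b.+1 else 0.

Definition exec (a : instr) (c : config) : config :=
  let: Config k w R := c in
  match a with
  | Iconst r v => Config k.+1 w [eta R with r |-> v]
  | Iadd r s t => Config k.+1 w [eta R with r |-> R s + R t]
  | Isub r s t => Config k.+1 w [eta R with r |-> R s - R t]
  | Ifetch r s => Config k.+1 w [eta R with r |-> R (R s)]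
  | Istore r s => Config k.+1 w [eta R with R r |-> R s]
  | Ijpos r l => Config (if 0 < R r then l else k.+1) w R
  | Iread r => Config k.+1 (behead w) [eta R with r |-> next_symbol w]
  end.

Definition bitlen (k : nat) : nat := (trunc_log 2 k).+1.

(* Total bit length of all the addresses and register contents handled. *)
Definition instr_cost (a : instr) (R : nat -> nat) : nat :=
  match a with
  | Iconst r v => bitlen r + bitlen v
  | Iadd r s t | Isub r s t =>
      bitlen r + bitlen s + bitlen t + bitlen (R s) + bitlen (R t)
  | Ifetch r s => bitlen r + bitlen s + bitlen (R s) + bitlen (R (R s))
  | Istore r s => bitlen r + bitlen s + bitlen (R r) + bitlen (R s)
  | Ijpos r l => bitlen r + bitlen l + bitlen (R r)
  | Iread r => (bitlen r).+1
  end.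

Definition halted (P : program) (c : config) : bool := size P <= pc c.

Definition step (P : program) (c : config) : config :=
  if onth P (pc c) is Some a then exec a c else c.

Definition step_cost (P : program) (c : config) : nat :=
  if onth P (pc c) is Some a then instr_cost a (regs c) else 0.

Definition run (P : program) (w : seq bool) (t : nat) : config :=
  iter t (step P) (init_config w).

(* On input w, P halts within time T; it accepts, that is, it halts with a
   nonzero value in register 0, if and only if the answer is yes. *)
Definition decides_within (P : program) (w : seq bool) (T : nat)
    (yes : Prop) : Prop :=
  exists t : nat,
    [/\ halted P (run P w t),
        \sum_(k < t) step_cost P (run P w k) <= T
      & (regs (run P w t) 0 != 0) <-> yes].

(* The problem restricted to the instances that satisfy the promise; instances
   are presented through the encoding enc, which also determines the input
   length. *)
Definition poly_time_decidable (I : Type) (enc : I -> seq bool)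
    (promise yes : I -> Prop) : Prop :=
  exists (P : program) (p : {poly nat}),
    forall x : I, promise x ->
      decides_within P (enc x) (p.[size (enc x)])%R (yes x).

Local Open Scope ring_scope.

Record instance := Instance {
  nb_agents : nat;
  nb_projects : nat;
  demand : 'M[rat]_(nb_agents, nb_projects);
  demand_itv : forall i j, 0 <= demand i j <= 1
}.

Definition budget_feasible (R : realType) (m : nat) (x : 'rV[R]_m) : Prop :=
  \sum_(j < m) x 0 j <= 1.

Definition satisfied (R : realType) (I : instance) (tau : nat)
    (x : 'rV[R]_(nb_projects I)) (i : 'I_(nb_agents I)) : Prop :=
  (tau <= #|[set j | (ratr (demand I i j) <= x 0 j)%R]|)%N.

Definition all_agents_sat (R : realType) (tau : nat) (I : instance) : Prop :=
  exists x : 'rV[R]_(nb_projects I),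
    [/\ forall j, 0 <= x 0 j <= 1,
        budget_feasible x
      & forall i, satisfied tau x i].

Definition unit_total_demand (I : instance) : Prop :=
  forall i, \sum_(j < nb_projects I) demand I i j = 1.

Definition unary (k : nat) : seq bool := rcons (nseq k true) false.

Definition unary_rat (q : rat) : seq bool :=
  unary `|numq q|%N ++ unary `|denq q|%N.

(* n, m, then the demands row by row (agent by agent), as fractions in lowest
   terms; unary is a prefix code, so the encoding is injective. *)
Definition unary_encoding (I : instance) : seq bool :=
  unary (nb_agents I) ++ unary (nb_projects I) ++
  flatten [seq unary_rat (demand I i j)
          | i <- enum 'I_(nb_agents I), j <- enum 'I_(nb_projects I)].

Definition pseudopoly_time_decidable (promise yes : instance -> Prop) : Prop :=
  poly_time_decidable unary_encoding promise yes.

(* Main.v *)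
Require Import Defs.
From mathcomp Require Import all_boot all_order all_algebra reals zify.

(* Multiply all demands by the product D of all denominators, getting natural
   numbers c q l with sum D for every agent q. Suppose a natural solution x,
   raised to sum exactly D, leaves some demand unmet, and let (p, j) minimise
   the deficit delta = c p j - x j among the unmet demands. Agent p meets all
   the other projects, and the excesses x l - c p l over l <> j add up to delta.
   An agent q with an unmet project l has deficit at least delta there and none
   elsewhere, so c q l - c p l exceeds c q l' - c p l' for every l' <> l, j, up
   to a possible tie when the whole excess of p sits at l'; hence l is
   determined by p, j and the project z of largest excess. Trying all triples
   (p, j, z), and allocating to each project the largest demand of the agents
   that do not give it up, decides the problem.

   The number D has polynomially many bits, and products are only ever taken
   with input entries, so that repeated addition suffices. *)

Set Implicit Arguments.
Unset Strict Implicit.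
Unset Printing Implicit Defensive.

Import Order.TTheory GRing.Theory Num.Theory.

(** * Code generation *)

Definition reach (P : program) (T : nat) (c c' : config) : Prop :=
  exists2 t, t <= T & iter t (step P) c = c'.

Lemma reach_refl P c : reach P 0 c c.
Proof. by exists 0. Qed.

Lemma reach_trans P T1 T2 c1 c2 c3 :
  reach P T1 c1 c2 -> reach P T2 c2 c3 -> reach P (T1 + T2) c1 c3.
Proof.
move=> [t1 le1 <-] [t2 le2 <-]; exists (t2 + t1); last by rewrite iterD.
by rewrite addnC leq_add.
Qed.

Lemma reach_leq P T1 T2 c c' : T1 <= T2 -> reach P T1 c c' -> reach P T2 c c'.
Proof. by move=> leT [t let1 <-]; exists t => //; apply: leq_trans leT. Qed.

Definition code_at (P : program) (p : nat) (s : seq instr) : Prop :=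
  forall i, i < size s -> onth P (p + i) = onth s i.

Lemma code_at_cat P p s1 s2 :
  code_at P p (s1 ++ s2) -> code_at P p s1 /\ code_at P (p + size s1) s2.
Proof.
move=> atP; split=> i lti; last first.
  have := atP (size s1 + i); rewrite size_cat ltn_add2l addnA => -> //.
  by rewrite onth_cat ltnNge leq_addr addKn.
by have := atP i; rewrite size_cat onth_cat lti => -> //; rewrite ltn_addr.
Qed.

Lemma code_at_cons P p a s :
  code_at P p (a :: s) -> onth P p = Some a /\ code_at P p.+1 s.
Proof.
move=> atP; split; first by have := atP 0 isT; rewrite addn0.
by move=> i lti; rewrite addSnnS; apply: (atP i.+1).
Qed.

Lemma reach_exec P T c2 a k w R :
  onth P k = Some a -> reach P T (exec a (Config k w R)) c2 ->
  reach P T.+1 (Config k w R) c2.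
Proof.
move=> Pk; rewrite -add1n; apply: reach_trans.
by exists 1; rewrite //= /step /= Pk.
Qed.

(* The input array lives in the even registers, the variables of a compiled
   term in the odd ones. *)
Definition reg (x : nat) : nat := x.*2.+1.

Lemma eq_reg x y : (reg x == reg y) = (x == y).
Proof. by rewrite /reg eqSS; lia. Qed.

Lemma even_reg k x : (k.*2 == reg x) = false.
Proof. rewrite /reg; lia. Qed.

(** The frame condition: code working at level [d] may change only odd registers of level at least
    [d]. *)
Definition agree (d : nat) (R R' : nat -> nat) : Prop :=
  (forall k, R' k.*2 = R k.*2) /\ (forall x, x < d -> R' (reg x) = R (reg x)).

Lemma agree_trans d R1 R2 R3 : agree d R1 R2 -> agree d R2 R3 -> agree d R1 R3.
Proof.
move=> [a12 b12] [a23 b23]; split=> [k|x ltx]; first by rewrite a23.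
by rewrite b23 ?b12.
Qed.

Lemma agree_leq d d' R R' : d <= d' -> agree d' R R' -> agree d R R'.
Proof.
by move=> led [a b]; split=> // x ltx; apply: b; apply: leq_trans led.
Qed.

Lemma agree_set d R R' x v :
  d <= x -> agree d R R' -> agree d R [eta R' with reg x |-> v].
Proof.
move=> led [a b]; split=> [k|y lty] /=; first by rewrite even_reg a.
by rewrite eq_reg ltn_eqF ?b // (leq_trans lty).
Qed.

(** [A] is the input array; a pair [(x, v)] in [G] records that the variable kept at level [x] has
    value [v]. These levels lie below [d], so [agree d] preserves them. *)
Definition valuation_ok (A : nat -> nat) (G : seq (nat * nat)) (d : nat)
    (R : nat -> nat) : Prop :=
  (forall k, R k.*2 = A k) /\
  (forall x v, (x, v) \in G -> x < d /\ R (reg x) = v).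

Lemma valuation_ok_agree A G d d' R R' :
  valuation_ok A G d R -> d <= d' -> agree d R R' -> valuation_ok A G d' R'.
Proof.
move=> [okA okG] led [a b]; split=> [k|x v Gx]; first by rewrite a okA.
by have [ltx <-] := okG _ _ Gx; rewrite b // (leq_trans ltx).
Qed.

Lemma valuation_ok_cons A G d R x v :
  x < d -> R (reg x) = v -> valuation_ok A G d R ->
  valuation_ok A ((x, v) :: G) d R.
Proof.
move=> ltx Rx [okA okG]; split=> // y u; rewrite inE => /orP[/eqP[-> ->] //|].
exact: okG.
Qed.

Ltac decide_eqs :=
  repeat match goal with |- context [@eq_op _ ?a ?b] =>
    first [ have -> : (a == b) = true by lia
          | have -> : (a == b) = false by lia ]
  end.
Ltac decide_regs := rewrite /= ?eq_reg; decide_eqs.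

(* A code generator takes the address at which its code is placed, because
   jumps are absolute. *)
Definition generator := nat -> seq instr.

Definition gcat (g1 g2 : generator) : generator :=
  fun p => g1 p ++ g2 (p + size (g1 p)).

(** The contract of generated code: the result goes to level [d], and higher levels are scratch.
    Quantifying over [P] and [p] makes the code relocatable. *)
Definition computes (A : nat -> nat) (G : seq (nat * nat)) (d : nat)
    (g : generator) (v T : nat) : Prop :=
  forall P p w R, code_at P p (g p) -> valuation_ok A G d R ->
  exists R', [/\ reach P T (Config p w R) (Config (p + size (g p)) w R'),
                 agree d R R' & R' (reg d) = v].

Definition gvar d x : generator :=
  fun=> [:: Iconst (reg d) 0; Iadd (reg d) (reg d) (reg x)].

Lemma computes_var A G d x v : (x, v) \in G -> computes A G d (gvar d x) v 2.
Proof.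
move=> Gx P p w R /code_at_cons[P0 /code_at_cons[P1 _]] [okA okG].
have [ltx Rx] := okG _ _ Gx.
eexists; split.
- apply: reach_exec P0 _; apply: reach_exec P1 _ => /=.
  by rewrite !addnS addn0; apply: reach_refl.
- by apply: agree_set => //; apply: agree_set.
- by rewrite /= !eqxx eq_reg ltn_eqF.
Qed.

Definition gconst d c : generator := fun=> [:: Iconst (reg d) c].

Lemma computes_const A G d c : computes A G d (gconst d c) c 1.
Proof.
move=> P p w R /code_at_cons[P0 _] _; eexists; split.
- by apply: reach_exec P0 _; rewrite /= addn1; apply: reach_refl.
- by apply: agree_set.
- by rewrite /= eqxx.
Qed.

Definition gop (op : nat -> nat -> nat -> instr) d (ga gb : generator) :=
  gcat ga (gcat gb (fun=> [:: op (reg d) (reg d) (reg d.+1)])).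

Lemma computes_op A G d op f ga gb va vb Ta Tb :
    (forall r s t k w R, exec (op r s t) (Config k w R) =
       Config k.+1 w [eta R with r |-> f (R s) (R t)]) ->
    computes A G d ga va Ta -> computes A G d.+1 gb vb Tb ->
  computes A G d (gop op d ga gb) (f va vb) (Ta + Tb + 1).
Proof.
move=> opE ha hb P p w R /code_at_cat[Pa].
move=> /code_at_cat[Pb /code_at_cons[Pop _]] okR.
have [R1 [reach1 agree1 R1a]] := ha P p w R Pa okR.
have [|R2 [reach2 agree2 R2b]] := hb P _ w R1 Pb.
  exact: valuation_ok_agree okR (leqnSn d) agree1.
eexists; split.
- rewrite -addnA; apply: reach_trans reach1 _; apply: reach_trans reach2 _.
  apply: reach_exec Pop _; rewrite opE /= /gop /gcat !size_cat /= !addnA addn1.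
  exact: reach_refl.
- apply: agree_set => //; apply: agree_trans agree1 _.
  exact: agree_leq (leqnSn d) agree2.
- by rewrite /= eqxx R2b (proj2 agree2) // R1a.
Qed.

(** Entry [k] sits in register [k.*2], hence the doubling before the fetch. *)
Definition gget d ga : generator :=
  gcat ga (fun=> [:: Iadd (reg d) (reg d) (reg d); Ifetch (reg d) (reg d)]).

Lemma computes_get A G d ga va Ta :
  computes A G d ga va Ta -> computes A G d (gget d ga) (A va) (Ta + 2).
Proof.
move=> ha P p w R /code_at_cat[Pa].
move=> /code_at_cons[P1 /code_at_cons[P2 _]] okR.
have [R1 [reach1 agree1 R1a]] := ha P p w R Pa okR.
eexists; split.
- apply: reach_trans reach1 _; apply: reach_exec P1 _; apply: reach_exec P2 _.
  rewrite /= /gget /gcat !size_cat /= addnA !addnS addn0.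
  exact: reach_refl.
- by apply: agree_set => //; apply: agree_set.
- rewrite /= !eqxx R1a addnn even_reg.
  by rewrite (proj1 agree1); apply: (proj1 okR).
Qed.

(** There is no unconditional jump: the else branch comes first and skips the other one by testing a
    register just set to 1. *)
Definition gite d (gc ga gb : generator) : generator := fun p =>
  let s := gc p in
  let sb := gb (p + size s).+1 in
  let l := (p + size s + size sb).+3 in
  let sa := ga l in
  s ++ Ijpos (reg d) l :: sb ++
  [:: Iconst (reg d.+1) 1, Ijpos (reg d.+1) (l + size sa) & sa].

Lemma computes_ite A G d gc ga gb vc va vb Tc Ta Tb :
    computes A G d gc vc Tc -> computes A G d ga va Ta ->
    computes A G d gb vb Tb ->
  computes A G d (gite d gc ga gb) (if 0 < vc then va else vb)
    (Tc + Ta + Tb + 3).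
Proof.
move=> hc ha hb P p w R; rewrite /gite.
set s := gc p; set sb := gb _; set l := _.+3; set sa := ga l.
move=> /code_at_cat[Pc] /code_at_cons[Pj] /code_at_cat[Pb].
move=> /code_at_cons[P1 /code_at_cons[P2 Pa]] okR.
have [R1 [reach1 agree1 R1c]] := hc P p w R Pc okR.
have okR1 := valuation_ok_agree okR (leqnn d) agree1.
have -> : p + size (s ++ Ijpos (reg d) l :: sb ++
    [:: Iconst (reg d.+1) 1, Ijpos (reg d.+1) (l + size sa) & sa]) =
    l + size sa.
  by rewrite /l !size_cat /= !size_cat /=; lia.
case: ifP => c_gt0.
  have eql : ((p + size s).+1 + size sb).+2 = l by rewrite /l; lia.
  rewrite eql in Pa.
  have [R2 [reach2 agree2 R2a]] := ha P l w R1 Pa okR1.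
  exists R2; split=> //; last exact: agree_trans agree2.
  apply: (@reach_leq _ (Tc + Ta.+1)); first lia.
  apply: reach_trans reach1 _; apply: reach_exec Pj _.
  by rewrite /= R1c c_gt0.
have [R2 [reach2 agree2 R2b]] := hb P _ w R1 Pb okR1.
eexists; split.
- apply: (@reach_leq _ (Tc + (Tb + 2).+1)); first lia.
  apply: reach_trans reach1 _; apply: reach_exec Pj _.
  rewrite /= R1c c_gt0; apply: reach_trans reach2 _.
  apply: reach_exec P1 _; apply: reach_exec P2 _ => /=.
  by rewrite eqxx; apply: reach_refl.
- by apply: agree_set => //; apply: agree_trans agree2.
- by rewrite /= eq_reg ltn_eqF.
Qed.

(** Level [d] holds the accumulator, [d.+1] the number of iterations, [d.+2] the counter; [d.+3]
    serves the exit test and then receives the value of the body. The loop head is [l]. *)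
Definition grec d (gi gk gf : generator) : generator := fun p =>
  let si := gi p in
  let sk := gk (p + size si) in
  let l := (p + size si + size sk).+1 in
  let sf := gf (l + 4) in
  si ++ sk ++ Iconst (reg d.+2) 0 ::
  [:: Isub (reg d.+3) (reg d.+1) (reg d.+2); Ijpos (reg d.+3) (l + 4);
      Iconst (reg d.+3) 1; Ijpos (reg d.+3) (l + 4 + size sf + 5)] ++ sf ++
  [:: Iconst (reg d) 0; Iadd (reg d) (reg d) (reg d.+3);
      Iconst (reg d.+3) 1; Iadd (reg d.+2) (reg d.+2) (reg d.+3);
      Ijpos (reg d.+3) l].

Lemma computes_rec A G d gi gk gf vi vk f Ti Tk Tf :
    computes A G d gi vi Ti -> computes A G d.+1 gk vk Tk ->
    (forall i s, computes A ((d.+2, i) :: (d, s) :: G) d.+3 gf (f i s) Tf) ->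
  computes A G d (grec d gi gk gf) (iteri vk f vi)
    (Ti + Tk + 5 + vk * (Tf + 7)).
Proof.
move=> hi hk hf P p w R; rewrite /grec.
set si := gi p; set sk := gk _; set l := (p + size si + size sk).+1.
set sf := gf _.
set e := l + 4 + size sf + 5.
move=> /code_at_cat[Pi] /code_at_cat[Pk] /code_at_cons[P0] /code_at_cat[].
move=> /code_at_cons[L0 /code_at_cons[L1]].
move=> /code_at_cons[L2 /code_at_cons[L3 _]].
rewrite -[(_ + size sk).+1]/l [size _]/= in L0 L1 L2 L3 *.
move=> /code_at_cat[Pf /code_at_cons[E0 /code_at_cons[E1]]].
move=> /code_at_cons[E2 /code_at_cons[E3 /code_at_cons[E4 _]]] okR.
have [R1 [reach1 agree1 R1i]] := hi P p w R Pi okR.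
have [|R2 [reach2 agree2 R2k]] := hk P _ w R1 Pk.
  exact: valuation_ok_agree okR (leqnSn d) agree1.
have agR2 : agree d R R2.
  by apply: agree_trans agree1 _; apply: agree_leq agree2.
(* Invariant at the loop head, by induction on the remaining iterations. Leaving takes 4 steps; a
   round takes two for the test, [Tf] for the body and five for the updates. *)
have loop i R3 : i <= vk -> R3 (reg d) = iteri i f vi -> R3 (reg d.+1) = vk ->
    R3 (reg d.+2) = i -> agree d R R3 ->
  exists R', [/\ reach P (4 + (vk - i) * (Tf + 7)) (Config l w R3)
                   (Config e w R'), agree d R R' & R' (reg d) = iteri vk f vi].
  have [n] := ubnP (vk - i); elim: n i R3 => // n IH i R3 ltn lei Ra Rk Ri agR3.
  have [eq_i|lt_i] := eqVneq i vk.
    eexists; split.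
    - rewrite eq_i subnn mul0n addn0.
      apply: reach_exec L0 _; apply: reach_exec L1 _.
      rewrite /= eqxx Rk Ri eq_i subnn /=.
      apply: reach_exec L2 _; apply: reach_exec L3 _.
      by rewrite /= eqxx; apply: reach_refl.
    - by do 2! [apply: agree_set; first lia].
    - by rewrite /= !eq_reg !ltn_eqF ?Ra ?eq_i //; lia.
  pose R4 := [eta R3 with reg d.+3 |-> vk - i].
  have agR4 : agree d.+3 R3 R4 by apply: agree_set.
  have [||R5 [reach5 agree5 R5f]] := hf i (iteri i f vi) P (l + 4) w R4 => //.
    apply: valuation_ok_cons => //; first by rewrite /R4 /= !eq_reg ltn_eqF.
    apply: valuation_ok_cons; first lia.
      by rewrite /R4 /= !eq_reg ltn_eqF //; lia.
    apply: (valuation_ok_agree okR); first lia.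
    by apply: agree_trans agR3 _; apply: agree_leq agR4; lia.
  have R5E x : x < d.+3 -> R5 (reg x) = R3 (reg x).
    by move=> ltx; rewrite (proj2 agree5) // (proj2 agR4).
  have [R6 [reach6 agR6 [R6a R6k R6i]]] : exists R6,
      [/\ reach P (Tf + 7) (Config l w R3) (Config l w R6), agree d R R6 &
       [/\ R6 (reg d) = iteri i.+1 f vi, R6 (reg d.+1) = vk
         & R6 (reg d.+2) = i.+1]].
    eexists; split; [| |split].
    - apply: (@reach_leq _ (Tf + 5).+2); first lia.
      apply: reach_exec L0 _; apply: reach_exec L1 _.
      rewrite /= Rk Ri -/R4 !eqxx subn_gt0 ltn_neqAle lt_i lei.
      apply: reach_trans reach5 _.
      apply: reach_exec E0 _; apply: reach_exec E1 _; apply: reach_exec E2 _.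
      apply: reach_exec E3 _; apply: reach_exec E4 _.
      by rewrite /= eq_reg gtn_eqF // eqxx; apply: reach_refl.
    - do 4! [apply: agree_set; first lia].
      apply: agree_trans agR3 _; apply: (@agree_leq _ d.+3); first lia.
      exact: agree_trans agree5.
    - by decide_regs; rewrite R5f.
    - by decide_regs; rewrite R5E ?Rk //; lia.
    - by decide_regs; rewrite R5E ?Ri ?addn1 //; lia.
  have [||R' [reachR' agR' R'a]] := IH i.+1 R6 _ _ R6a R6k R6i agR6.
  - by move: lt_i ltn lei; lia.
  - by move: lt_i lei; lia.
  exists R'; split=> //; apply: reach_leq (reach_trans reach6 reachR').
  have -> : vk - i = (vk - i.+1).+1 by move: lt_i lei; lia.
  by rewrite mulSn; lia.
pose R3 := [eta R2 with reg d.+2 |-> 0].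
have [|||||R' [reachR' agR' R'a]] := loop 0 R3 => //.
- by rewrite /R3 /= eq_reg ltn_eqF ?(proj2 agree2) //; lia.
- by rewrite /R3 /= eq_reg ltn_eqF.
- by rewrite /R3 /= eqxx.
- by apply: agree_set => //; lia.
exists R'; split=> //.
have -> : p + size (si ++ sk ++ Iconst (reg d.+2) 0 ::
  [:: Isub (reg d.+3) (reg d.+1) (reg d.+2); Ijpos (reg d.+3) (l + 4);
      Iconst (reg d.+3) 1; Ijpos (reg d.+3) e] ++ sf ++
  [:: Iconst (reg d) 0; Iadd (reg d) (reg d) (reg d.+3);
      Iconst (reg d.+3) 1; Iadd (reg d.+2) (reg d.+2) (reg d.+3);
      Ijpos (reg d.+3) l]) = e.
  by rewrite /e /l !size_cat /= !size_cat /=; lia.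
apply: (@reach_leq _ (Ti + (Tk + (4 + (vk - 0) * (Tf + 7)).+1))).
  by rewrite subn0; lia.
apply: reach_trans reach1 _; apply: reach_trans reach2 _.
exact: reach_exec P0 reachR'.
Qed.

(** * A term language and its compilation *)

(* Rec k a f iterates f from a, and the number of iterations is the entry k of
   the input array, so that nested loops run in polynomial time in the largest
   entry. Binders are represented by functions (PHOAS): V is nat in both
   readings, namely a register level for compile, a value for eval. *)
Inductive term (V : Type) : Type :=
| Var of V
| Const of nat
| Plus of term V & term V
| Minus of term V & term V
| Get of term V
| Ite of term V & term V & term V
| Rec of term V & term V & (V -> V -> term V).
Arguments Const {V}.

Fixpoint eval (A : nat -> nat) (e : term nat) : nat :=
  match e with
  | Var v => v
  | Const c => c
  | Plus a b => eval A a + eval A b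
  | Minus a b => eval A a - eval A b
  | Get a => A (eval A a)
  | Ite c a b => if 0 < eval A c then eval A a else eval A b
  | Rec k a f =>
      iteri (A (eval A k)) (fun i s => eval A (f i s)) (eval A a)
  end.

Fixpoint compile (e : term nat) (d : nat) : generator :=
  match e with
  | Var x => gvar d x
  | Const c => gconst d c
  | Plus a b => gop Iadd d (compile a d) (compile b d.+1)
  | Minus a b => gop Isub d (compile a d) (compile b d.+1)
  | Get a => gget d (compile a d)
  | Ite c a b => gite d (compile c d) (compile a d) (compile b d)
  | Rec k a f =>
      grec d (compile a d) (gget d.+1 (compile k d.+1))
        (compile (f d.+2 d) d.+3)
  end.

Section TimeBound.
Local Open Scope ring_scope.

(** The indeterminate stands for a bound on the array entries, hence on the iterations of every
    [Rec]. *)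
Fixpoint time_bound (e : term nat) (d : nat) : {poly nat} :=
  match e with
  | Var _ => 2%:P
  | Const _ => 1%:P
  | Plus a b | Minus a b => time_bound a d + time_bound b d.+1 + 1%:P
  | Get a => time_bound a d + 2%:P
  | Ite c a b => time_bound c d + time_bound a d + time_bound b d + 3%:P
  | Rec k a f =>
      time_bound a d + (time_bound k d.+1 + 2%:P) + 5%:P
      + 'X * (time_bound (f d.+2 d) d.+3 + 7%:P)
  end.

End TimeBound.

(** The logical relation between the two readings of a PHOAS term: [G] pairs each register level
    with the value of the same variable. *)
Inductive related : seq (nat * nat) -> term nat -> term nat -> Prop :=
| related_var G x v : (x, v) \in G -> related G (Var x) (Var v)
| related_const G c : related G (Const c) (Const c)
| related_add G a a' b b' :
    related G a a' -> related G b b' -> related G (Plus a b) (Plus a' b')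
| related_sub G a a' b b' :
    related G a a' -> related G b b' -> related G (Minus a b) (Minus a' b')
| related_get G a a' : related G a a' -> related G (Get a) (Get a')
| related_ite G c c' a a' b b' :
    related G c c' -> related G a a' -> related G b b' ->
    related G (Ite c a b) (Ite c' a' b')
| related_rec G k k' a a' f f' :
    related G k k' -> related G a a' ->
    (forall i u s v,
       related ((i, u) :: (s, v) :: G) (f i s) (f' u v)) ->
    related G (Rec k a f) (Rec k' a' f').

Lemma computes_leq A G d g v T T' :
  T <= T' -> computes A G d g v T -> computes A G d g v T'.
Proof.
move=> leT h P p w R Pg okR; have [R' [r a e]] := h P p w R Pg okR.
by exists R'; split=> //; apply: reach_leq r.
Qed.

(** The body of [Rec] is a function, so the induction is on [related], whose premise on bodies is
    used at the levels [d.+2] and [d] picked by [compile]. *)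
Lemma computes_compile A L G e e' d :
    (forall k, A k <= L) -> related G e e' ->
  computes A G d (compile e d) (eval A e') (time_bound e d).[L]%R.
Proof.
move=> leA rel; elim: rel d => {G e e'} /=.
- by move=> G x v Gx d; rewrite hornerC; apply: computes_var.
- by move=> G c d; rewrite hornerC; apply: computes_const.
- move=> G a a' b b' _ IHa _ IHb d; rewrite !hornerD hornerC.
  exact: (@computes_op A G d Iadd addn).
- move=> G a a' b b' _ IHa _ IHb d; rewrite !hornerD hornerC.
  exact: (@computes_op A G d Isub subn).
- move=> G a a' _ IHa d; rewrite !hornerD hornerC; exact: computes_get.
- move=> G c c' a a' b b' _ IHc _ IHa _ IHb d; rewrite !hornerD hornerC.
  exact: computes_ite.
move=> G k k' a a' f f' _ IHk _ IHa _ IHf d.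
rewrite !hornerD hornerM !hornerD !hornerC hornerX.
apply: (@computes_leq _ _ _ _ _ _ _ _ (computes_rec (IHa d)
  (computes_get (IHk d.+1)) (fun i s => IHf d.+2 i d s d.+3))).
by rewrite leq_add2l leq_mul2r leA orbT.
Qed.

(** * Logarithmic cost of a run *)

(* Only Iadd produces new large values, at most doubling the largest one. *)
Definition instr_bounded (K : nat) (a : instr) : bool :=
  match a with
  | Iconst r v => (r <= K) && (v <= K)
  | Iadd r s t | Isub r s t => [&& r <= K, s <= K & t <= K]
  | Ifetch r s | Istore r s | Ijpos r s => (r <= K) && (s <= K)
  | Iread r => r <= K
  end.

Lemma instr_bounded_leq K K' a :
  K <= K' -> instr_bounded K a -> instr_bounded K' a.
Proof. by case: a => /= *; lia. Qed.

(** The bound [2 <= K] covers the symbol codes 0, 1 and 2 stored by [Iread]. *)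
Lemma program_bounded P :
  exists2 K, 2 <= K & forall k a, onth P k = Some a -> instr_bounded K a.
Proof.
elim: P => [|b P [K K2 IH]]; first by exists 2 => // -[].
have [Kb Kb2] : exists Kb, instr_bounded Kb b.
  case: b => [r v|r s t|r s t|r s|r s|r s|r];
    by [exists r => /=; lia | exists (r + v) => /=; lia
      | exists (r + s) => /=; lia | exists (r + s + t) => /=; lia].
exists (K + Kb) => [|[|k] a /=]; first lia.
  by move=> [<-]; apply: instr_bounded_leq Kb2; lia.
by move/IH; apply: instr_bounded_leq; lia.
Qed.

Lemma regs_run_bound P w K t :
    2 <= K -> (forall k a, onth P k = Some a -> instr_bounded K a) ->
  forall r, regs (run P w t) r <= K * 2 ^ t.
Proof.
move=> K2 bP; elim: t => [|t IH] r; first by rewrite /run.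
rewrite /run iterS -/(run P w t).
move: (run P w t) IH => [k w' R] /= IH.
have exp_gt0 := expn_gt0 2 t.
have K_le : K <= K * 2 ^ t.+1 by rewrite leq_pmulr ?expn_gt0.
have IH' x : R x <= K * 2 ^ t.+1.
  by apply: leq_trans (IH x) _; rewrite leq_pmul2l ?leq_exp2l //; lia.
rewrite /step /=; case Pk: (onth P k) => [a|] //=.
move: (bP _ _ Pk); case: a {Pk} => /= [s v|s u v|s u v|s u|s u|s u|s] bs //;
  try case: ifP => _ //.
- by apply: leq_trans K_le; lia.
- have := IH u; have := IH v; rewrite expnS mulnCA; lia.
- by apply: leq_trans (leq_subr _ _) _.
- by apply: leq_trans K_le; rewrite /next_symbol; case: (w') => [|[] ?]; lia.
Qed.

Lemma bitlen_leq K t x : x <= K * 2 ^ t -> bitlen x <= K + t + 1.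
Proof.
move=> lex; rewrite /bitlen addn1 ltnS.
have [->|x_gt0] := posnP x; first by rewrite trunc_log0.
rewrite -ltnS -(@ltn_exp2l 2) //; apply: leq_ltn_trans (trunc_logP _ x_gt0) _.
  by [].
apply: leq_ltn_trans lex _; rewrite -addSn expnD ltn_pmul2r ?expn_gt0 //.
by apply: leq_trans (ltn_expl K (isT : 1 < 2)) _; rewrite leq_exp2l.
Qed.

(** Each instruction is charged at most five bit lengths. *)
Lemma step_cost_bound P w K t :
    2 <= K -> (forall k a, onth P k = Some a -> instr_bounded K a) ->
  step_cost P (run P w t) <= 5 * (K + t + 1).
Proof.
move=> K2 bP; have bR := regs_run_bound w t K2 bP.
have bK x : x <= K -> bitlen x <= K + t + 1.
  move=> lex; apply: bitlen_leq; apply: leq_trans lex _.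
  by rewrite leq_pmulr ?expn_gt0.
have {}bR x : bitlen (regs (run P w t) x) <= K + t + 1 by apply: bitlen_leq.
rewrite /step_cost; case Pk: (onth P _) => [a|] //=.
move: (regs _) bR (bP _ _ Pk) => R bR.
by case: a {Pk} => /= [s v|s u v|s u v|s u|s u|s u|s] bs;
  try (have := bR s); try (have := bR u); try (have := bR v);
  try (have := bR (R s)); try (have := bR (R u));
  try (have := bK s); try (have := bK u); try (have := bK v); lia.
Qed.

(* After t steps all registers have O(t) bits, so T steps cost O(T^2). *)
Lemma poly_time_decidable_steps (I : Type) (enc : I -> seq bool)
    (promise yes : I -> Prop) (P : program) (q : {poly nat}) :
    (forall x, promise x -> exists2 c,
       reach P q.[size (enc x)]%R (init_config (enc x)) c &
       halted P c /\ (regs c 0 != 0 <-> yes x)) ->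
  poly_time_decidable enc promise yes.
Proof.
move=> hP; have [K K2 bP] := program_bounded P.
exists P, (q * (5%:P * (K%:P + q + 1%:P)))%R => x /hP[c [t let_ <-] [Hh Hy]].
exists t; split=> //.
rewrite !hornerM !hornerD !hornerC.
set T := (q.[_])%R in let_ *.
apply: (@leq_trans (\sum_(k < t) 5 * (K + T + 1))).
  apply: leq_sum => k _; apply: leq_trans (step_cost_bound _ _ K2 bP) _.
  have := ltn_ord k; lia.
by rewrite sum_nat_const card_ord leq_mul2r let_ orbT.
Qed.

(** * Reading the input *)

(* Registers 1, 3, 5, 7: address of the current array entry, last symbol read,
   the constant 1, scratch. A symbol true increments the current entry and a
   symbol false moves on to the next one. *)
Definition tape_reader : program :=
  [:: Iconst 5 1; Iconst 1 0;
      Iread 3; Ijpos 3 5; Ijpos 5 14;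
      Isub 3 3 5; Ijpos 3 10;
      Iadd 1 1 5; Iadd 1 1 5; Ijpos 5 2;
      Ifetch 7 1; Iadd 7 7 5; Istore 1 7; Ijpos 5 2].

Fixpoint unary_entries (w : seq bool) (k : nat) (A : nat -> nat) : nat -> nat :=
  match w with
  | [::] => A
  | true :: w' => unary_entries w' k [eta A with k |-> A k + 1]
  | false :: w' => unary_entries w' k.+1 A
  end.

Lemma eq_unary_entries w k A B :
  A =1 B -> unary_entries w k A =1 unary_entries w k B.
Proof.
elim: w k A B => [|[] w IH] k A B eqAB //=; apply: IH => // x /=.
by rewrite !eqAB.
Qed.

Lemma unary_entries_flatten s k A i :
  unary_entries (flatten (map unary s)) k A i =
  A i + (if i < k then 0 else nth 0 s (i - k)).
Proof.
elim: s k A => [|n s IH] k A /=; first by rewrite nth_nil if_same addn0.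
have -> : unary_entries (unary n ++ flatten (map unary s)) k A i =
    unary_entries (flatten (map unary s)) k.+1 [eta A with k |-> A k + n] i.
  elim: n A => [|n IHn] A.
    rewrite /unary /=; apply: eq_unary_entries => x /=.
    by case: eqP => // ->; rewrite addn0.
  rewrite /= -/(unary n) IHn; apply: eq_unary_entries => x /=.
  by rewrite eqxx; case: eqP => //; rewrite -addnA.
rewrite IH /= ltnS; have [->|nik] := eqVneq i k.
  by rewrite leqnn ltnn subnn addn0.
rewrite leq_eqVlt (negbTE nik) /=; case: ltnP => // leki.
by have -> : i - k = (i - k.+1).+1 by lia.
Qed.

(** Address 2 is the loop head. A symbol [true] takes eight steps, [false] seven, and the end of the
    input three. *)
Lemma tape_reader_loop P w k A R :
    code_at P 0 tape_reader -> R 5 = 1 -> R 1 = k.*2 ->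
    (forall i, R i.*2 = A i) ->
  exists2 R', reach P (8 * size w + 3) (Config 2 w R) (Config 14 [::] R') &
              forall i, R' i.*2 = unary_entries w k A i.
Proof.
move=> atP; have Pn i : i < 14 -> onth P i = onth tape_reader i := atP i.
elim: w k A R => [|b w IH] k A R R5 R1 RA.
  eexists.
    apply: reach_exec (Pn 2 isT) _; apply: reach_exec (Pn 3 isT) _.
    apply: reach_exec (Pn 4 isT) _.
    by rewrite /= R5; apply: reach_refl.
  by move=> i /=; have -> : (i.*2 == 3) = false by lia.
case: b => /=.
  pose R2 := [eta [eta [eta [eta [eta R with 3 |-> 2] with 3 |-> 1]
    with 7 |-> A k] with 7 |-> A k + 1] with k.*2 |-> A k + 1].
  have [|||R' r e] := IH k [eta A with k |-> A k + 1] R2.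
  - by rewrite /R2 /=; decide_eqs.
  - by rewrite /R2 /=; decide_eqs.
  - move=> i; rewrite /R2 /= RA.
    have -> : (i.*2 == k.*2) = (i == k) by lia.
    by case: (i == k) => //; decide_eqs.
  exists R' => //; apply: (@reach_leq _ (8 * size w + 3).+4.+4); first lia.
  apply: reach_exec (Pn 2 isT) _; apply: reach_exec (Pn 3 isT) _.
  apply: reach_exec (Pn 5 isT) _; rewrite /= R5.
  apply: reach_exec (Pn 6 isT) _; apply: reach_exec (Pn 10 isT) _.
  apply: reach_exec (Pn 11 isT) _; apply: reach_exec (Pn 12 isT) _.
  apply: reach_exec (Pn 13 isT) _.
  rewrite /= R1 R5 /=; decide_eqs.
  by rewrite RA.
pose R2 := [eta [eta [eta [eta R with 3 |-> 1] with 3 |-> 0]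
  with 1 |-> k.*2 + 1] with 1 |-> k.*2 + 1 + 1].
have [|||R' r e] := IH k.+1 A R2 => //.
- by rewrite /R2 /=; lia.
- move=> i; rewrite /R2 /=.
  have -> : (i.*2 == 1) = false by lia.
  by have -> : (i.*2 == 3) = false by lia.
exists R' => //; apply: (@reach_leq _ (8 * size w + 3).+4.+3); first lia.
apply: reach_exec (Pn 2 isT) _; apply: reach_exec (Pn 3 isT) _.
apply: reach_exec (Pn 5 isT) _; rewrite /= R5.
apply: reach_exec (Pn 6 isT) _; apply: reach_exec (Pn 7 isT) _.
apply: reach_exec (Pn 8 isT) _; apply: reach_exec (Pn 9 isT) _.
by rewrite /= R1 R5.
Qed.

(** Here the unary encoding matters: it bounds all loop counts by the input length. *)
Lemma leq_nth_size_unary s k : nth 0 s k <= size (flatten (map unary s)).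
Proof.
elim: s k => [|n s IH] [|k] //=; rewrite size_cat size_rcons size_nseq.
  by lia.
by apply: leq_trans (IH k) _; rewrite leq_addl.
Qed.

Lemma poly_time_decidable_term (I : Type) (entries : I -> seq nat)
    (enc : I -> seq bool) (promise yes : I -> Prop) (e : term nat) :
    related [::] e e ->
    (forall x, enc x = flatten (map unary (entries x))) ->
    (forall x, promise x -> eval (nth 0 (entries x)) e != 0 <-> yes x) ->
  poly_time_decidable enc promise yes.
Proof.
move=> rel_e encE yesE.
(* The reader fills addresses 0 to 13. The term leaves its value in [reg 0], which is register 1,
   and the last two instructions copy it to register 0. *)
pose ce := compile e 0 14.
pose P := tape_reader ++ ce ++ [:: Iconst 3 0; Iadd 0 1 3].
apply: (@poly_time_decidable_steps _ _ _ _ P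
  (2%:P + (8%:P * 'X + 3%:P) + time_bound e 0 + 2%:P)%R) => x /yesE {}yesE.
have atP : code_at P 0 P by [].
have [atr /code_at_cat[ate]] := code_at_cat atP.
move=> /code_at_cons[Q0 /code_at_cons[Q1 _]].
have Pn i : i < 14 -> onth P i = onth tape_reader i := atr i.
pose R0 : nat -> nat := [eta [eta (fun=> 0) with 5 |-> 1] with 1 |-> 0].
have [|||R1 reach1 R1E] := @tape_reader_loop P (enc x) 0 (fun=> 0) R0 atr => //.
  by move=> i; rewrite /R0 /=; do 2! case: eqP => //; lia.
have leA k : nth 0 (entries x) k <= size (enc x).
  by rewrite encE leq_nth_size_unary.
have [|R2 [reach2 _ R2e]] :=
  @computes_compile _ _ _ _ _ 0 leA rel_e P 14 [::] R1 ate.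
  by split=> // k; rewrite R1E encE unary_entries_flatten /= subn0.
eexists.
  rewrite !hornerD hornerM !hornerC hornerX.
  apply: reach_trans; first apply: reach_trans reach2.
    apply: reach_trans reach1.
    apply: reach_exec (Pn 0 isT) _; apply: reach_exec (Pn 1 isT) _.
    exact: reach_refl.
  apply: reach_exec Q0 _; apply: reach_exec Q1 _; exact: reach_refl.
split.
  by rewrite /halted /= !size_cat /=; lia.
by rewrite /= addn0 R2e.
Qed.

(** * Guessing which project each agent gives up *)

Section Reconstruction.

Variables (A B : finType) (c : A -> B -> nat) (D : nat).
Implicit Types (p q : A) (j z l : B) (x : B -> nat).

(** Allocations in units of [1 / D]; threshold [m - 1] becomes at most one unmet project per
    agent. *)
Definition feasible x : Prop :=
  \sum_l x l <= D /\
  forall q l l', x l < c q l -> x l' < c q l' -> l = l'.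

(** Against [j], only the comparison of [c q j] with [c p j] counts. Other projects compete by
    [c q l - c p l], written additively to avoid truncation; a tie with [z] goes against [z]. *)
Definition beats p j z q l l' : bool :=
  if l == j then c p j <= c q j
  else if l' == j then c q j < c p j
  else c q l' + c p l < c q l + c p l' + (l' == z).

Definition gives_up p j z q l : bool :=
  [forall l', (l == l') || beats p j z q l l'].

Definition allocation p j z l : nat :=
  \max_(q | ~~ gives_up p j z q l) c q l.

(** Two distinct projects cannot beat each other. *)
Lemma gives_up_inj p j z q l l' :
  gives_up p j z q l -> gives_up p j z q l' -> l = l'.
Proof.
move=> /forallP/(_ l') + /forallP/(_ l); rewrite [l' == l]eq_sym.
case: (eqVneq l l') => //= nll'; rewrite /beats.
case: (eqVneq l j) => [lj|nlj]; case: (eqVneq l' j) => [l'j|nl'j]; try lia.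
  by rewrite lj l'j eqxx in nll'.
case: (eqVneq l z) => [lz|_]; case: (eqVneq l' z) => [l'z|_]; try lia.
by rewrite lz l'z eqxx in nll'.
Qed.

Lemma feasible_allocation p j z :
  \sum_l allocation p j z l <= D -> feasible (allocation p j z).
Proof.
move=> leD; split=> // q l l'.
have up k : allocation p j z k < c q k -> gives_up p j z q k.
  apply: contraTT => ngu; rewrite -leqNgt.
  exact: (@leq_bigmax_cond _ (fun q => ~~ gives_up p j z q k) (c^~ k)).
by move=> /up h /up; apply: gives_up_inj h.
Qed.

Hypothesis sum_c : forall q, \sum_l c q l = D.

(** Completeness of the right guess. The condition [z != j] stands under the quantifier so that any
    [z] is admissible when [j] is the only project. *)
Lemma gives_upP x p j z q l :
    \sum_l x l = D -> (forall q l l', x l < c q l -> x l' < c q l' -> l = l') ->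
    x j < c p j ->
    (forall q l, x l < c q l -> c p j - x j <= c q l - x l) ->
    (forall l, l != j -> z != j /\ x l - c p l <= x z - c p z) ->
  x l < c q l -> gives_up p j z q l.
Proof.
move=> sum_x x_ok ltj minj maxz ltl; apply/forallP=> l'.
have [//|nll' /=] := eqVneq l l'; rewrite /beats.
have q_ok k : k != l -> c q k <= x k.
  by move=> nkl; rewrite leqNgt; apply: contraNN nkl => /x_ok/(_ ltl)->.
have p_ok k : k != j -> c p k <= x k.
  by move=> nkj; rewrite leqNgt; apply: contraNN nkj => /x_ok/(_ ltj)->.
have minl := minj _ _ ltl.
have [eql|nlj] := eqVneq l j; first by move: minl; rewrite eql in ltl *; lia.
have [eql'|nl'j] := eqVneq l' j.
  have := q_ok j; rewrite -eql' eq_sym nll' => /(_ isT); rewrite eql'; lia.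
(* Both [x] and [c p] sum to [D], so what [p] lacks at [j] equals its surplus elsewhere. *)
have excess : \sum_(k | k != j) (x k - c p k) = c p j - x j.
  have := sum_c p; rewrite -sum_x (bigD1 j) //= [RHS](bigD1 j) //=.
  rewrite -(eq_bigr _ (fun k nkj => subnKC (p_ok k nkj))) big_split /=; lia.
have pair k k' : k != j -> k' != j -> k != k' ->
    (x k - c p k) + (x k' - c p k') <= c p j - x j.
  move=> kj k'j kk'; rewrite -excess (bigD1 k) //= (bigD1 k') /=; first lia.
  by rewrite k'j eq_sym.
have := p_ok _ nlj; have := p_ok _ nl'j; have := pair _ _ nlj nl'j nll'.
have := q_ok l'; rewrite eq_sym nll' => /(_ isT).
(* Against [z] the weak inequality suffices. Otherwise the excess at [l'] is at most that at [z], so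
   twice it is at most the positive deficit of [p], which gives strictness. *)
have [_|nl'z] := eqVneq l' z; first by move: minl ltl; lia.
have [nzj lez] := maxz _ nl'j; have := pair _ _ nl'j nzj nl'z.
by move: minl ltl ltj; lia.
Qed.

(** Spending the leftover budget on [j] only meets more demands. *)
Lemma feasible_tight x j : feasible x -> exists y, \sum_l y l = D /\
  forall q l l', y l < c q l -> y l' < c q l' -> l = l'.
Proof.
move=> [leD x_ok].
exists [eta x with j |-> x j + (D - \sum_l x l)]; split.
  rewrite (bigD1 j) //= eqxx.
  have -> : \sum_(i | i != j) (if i == j then x j + (D - \sum_l x l) else x i) =
      \sum_(i | i != j) x i.
    by apply: eq_bigr => i /negbTE ->.
  by move: leD; rewrite (bigD1 j) //=; lia.
have le_y l : x l <= [eta x with j |-> x j + (D - \sum_l x l)] l.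
  by rewrite /=; case: eqP => // ->; lia.
by move=> q l l' ltl ltl'; apply: (x_ok q); [apply: leq_ltn_trans ltl
  | apply: leq_ltn_trans ltl'].
Qed.

Lemma feasible_iff : 0 < D -> 0 < #|A| ->
  (exists x, feasible x) <->
  exists p j z, \sum_l allocation p j z l <= D.
Proof.
move=> D_gt0 /card_gt0P[p0 _]; split=> [[x feas_x]|[p [j [z leD]]]]; last first.
  by exists (allocation p j z); apply: feasible_allocation.
have [j0 _|noB] := pickP B; last first.
  by move: D_gt0; rewrite -(sum_c p0) big_pred0.
have [y [sum_y y_ok]] := feasible_tight j0 feas_x.
pose P := [pred u : A * B | y u.2 < c u.1 u.2].
(* If [y] meets every demand, it dominates the allocation of any guess. *)
have [u0 Pu0|noP] := pickP P; last first.
  exists p0, j0, j0; rewrite -sum_y; apply: leq_sum => l _.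
  apply/bigmax_leqP => q _; rewrite leqNgt; apply/negP => lt.
  by have := noP (q, l); rewrite /= lt.
have [[p j] /= ltj minj] := arg_minnP (fun u => c u.1 u.2 - y u.2) Pu0.
have {}minj q l : y l < c q l -> c p j - y j <= c q l - y l.
  by move=> lt; apply: (minj (q, l)).
(* If [j] is the only project, the condition is vacuous and [z := j] will do. *)
have [z maxz] : exists z,
    forall l, l != j -> z != j /\ y l - c p l <= y z - c p z.
  have [l0 nl0|noB] := pickP [pred l | l != j]; last first.
    by exists j => l nlj; have := noB l; rewrite /= nlj.
  have [z nz maxz] := arg_maxnP (fun l => y l - c p l) nl0.
  by exists z => l nlj; split=> //; apply: maxz.
exists p, j, z; rewrite -sum_y; apply: leq_sum => l _.
apply/bigmax_leqP => q; rewrite leqNgt; apply: contraNN.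
exact: gives_upP sum_y y_ok ltj minj maxz.
Qed.

End Reconstruction.

(** * The decision procedure as a term *)

(* Entries 0 and 1 of the input array are the numbers of agents and projects;
   the numerator and the denominator of the demand of q for l follow at
   addresses 2 + 2 (q m + l) and 3 + 2 (q m + l). *)
Section Terms.

Variable V : Type.
Implicit Types (a b : term V) (p q j z l : V).

(** The factor is the entry at address [k], hence a legal loop count. *)
Definition mul_entry a k := Rec k (Const 0) (fun _ s => Plus (Var s) a).

Definition demand_addr q l :=
  let u := Plus (mul_entry (Var q) (Const 1)) (Var l) in
  Plus (Const 2) (Plus u u).

Definition prod_entries (addr : V -> V -> term V) :=
  Rec (Const 0) (Const 1) (fun q s =>
    Rec (Const 1) (Var s) (fun l s' => mul_entry (Var s') (addr q l))).

Definition differ p q := Plus (Minus (Var p) (Var q)) (Minus (Var q) (Var p)).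

Definition common_denom :=
  prod_entries (fun q l => Plus (demand_addr q l) (Const 1)).

(* The demand of q for l in units of 1 / common_denom: its denominator is
   replaced by its numerator in the product of all denominators. *)
Definition scaled_demand q l :=
  prod_entries (fun q' l' => Plus (demand_addr q' l')
    (Ite (Plus (differ q q') (differ l l')) (Const 1) (Const 0))).

(** A positive truncated difference encodes a strict inequality; adding [Const 1] makes it a weak
    one. *)
Definition beats_term p j z q l l' :=
  Ite (differ l j)
    (Ite (differ l' j)
       (Minus (Plus (Plus (scaled_demand q l) (scaled_demand p l'))
                 (Ite (differ l' z) (Const 0) (Const 1)))
            (Plus (scaled_demand q l') (scaled_demand p l)))
       (Minus (scaled_demand p j) (scaled_demand q j)))
    (Minus (Plus (scaled_demand q j) (Const 1)) (scaled_demand p j)).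

(** Counts the projects that [l] fails to beat; a positive value means that [q] does not give up
    [l]. *)
Definition not_beaten p j z q l :=
  Rec (Const 1) (Const 0) (fun l' s => Plus (Var s)
    (Ite (differ l l') (Ite (beats_term p j z q l l') (Const 0) (Const 1))
       (Const 0))).

(** The update [s + (v - s)] is the maximum of [s] and [v]. *)
Definition allocation_term p j z l :=
  Rec (Const 0) (Const 0) (fun q s => Plus (Var s)
    (Minus (Ite (not_beaten p j z q l) (scaled_demand q l) (Const 0)) (Var s))).

Definition total_term p j z :=
  Rec (Const 1) (Const 0) (fun l s => Plus (Var s) (allocation_term p j z l)).

(** A guess contributes a positive amount exactly when its total is at most the common denominator,
    so the sum acts as a disjunction. *)
Definition search_term :=
  Rec (Const 0) (Const 0) (fun p s => Rec (Const 1) (Var s) (fun j s =>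
    Rec (Const 1) (Var s) (fun z s =>
      Plus (Var s) (Minus (Plus common_denom (Const 1)) (total_term p j z))))).

(** Without agents the search is empty although the answer is yes. *)
Definition decision_term := Ite (Get (Const 0)) search_term (Const 1).

End Terms.

Lemma related_decision_term :
  related [::] (decision_term nat) (decision_term nat).
Proof.
by repeat first [apply: related_rec => [||????] | apply: related_ite
  | apply: related_add | apply: related_sub | apply: related_get
  | apply: related_const | apply: related_var; rewrite !inE !eqxx ?orbT].
Qed.

(** * Values of the terms *)

Section Eval.

Variable A : nat -> nat.
Notation n := (A 0).
Notation m := (A 1).

Lemma iteri_big (T : Type) (idx : T) (op : Monoid.law idx) k (F : nat -> T) x :
  iteri k (fun i s => op s (F i)) x = op x (\big[op/idx]_(i < k) F i).
Proof.
elim: k => [|k IH] /=; first by rewrite big_ord0 Monoid.mulm1.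
by rewrite IH big_ord_recr /= Monoid.mulmA.
Qed.

Lemma iteri_sum k F x : iteri k (fun i s => s + F i) x = x + \sum_(i < k) F i.
Proof. exact: (iteri_big addn). Qed.

Lemma eval_mul_entry a k :
  eval A (mul_entry a k) = eval A a * A (eval A k).
Proof.
by rewrite /= (iteri_sum _ (fun=> eval A a)) sum_nat_const card_ord mulnC.
Qed.

Lemma eval_demand_addr q l :
  eval A (@demand_addr nat q l) = 2 + (q * m + l).*2.
Proof. by rewrite -addnn -[q * m](eval_mul_entry (Var q) (Const 1)). Qed.

Lemma eval_prod_entries (addr : nat -> nat -> term nat) :
  eval A (prod_entries addr) =
  \prod_(q < n) \prod_(l < m) A (eval A (addr q l)).
Proof.
pose F q l := A (eval A (addr q l)).
rewrite /= -[RHS]mul1n -(iteri_big muln _ (fun q => \prod_(l < m) F q l)).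
apply: eq_iteri => q s; rewrite -(iteri_big muln _ (F q)).
by apply: eq_iteri => l s'; exact: (eval_mul_entry (Var s') (addr q l)).
Qed.

Lemma eval_differ p q : (0 < eval A (@differ nat p q)) = (p != q).
Proof. by rewrite /=; lia. Qed.

Lemma eval_common_denom : eval A (common_denom nat) =
  \prod_(q < n) \prod_(l < m) A (3 + (q * m + l).*2).
Proof.
rewrite eval_prod_entries; apply: eq_bigr => q _; apply: eq_bigr => l _.
congr A; transitivity (eval A (@demand_addr nat q l) + 1) => //.
by rewrite eval_demand_addr addnAC.
Qed.

Lemma eval_scaled_demand q l : eval A (@scaled_demand nat q l) =
  \prod_(q' < n) \prod_(l' < m)
    A ((if (q == q') && (l == l') then 2 else 3) + (q' * m + l').*2).
Proof.
rewrite eval_prod_entries; apply: eq_bigr => q' _; apply: eq_bigr => l' _.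
congr A; transitivity (eval A (@demand_addr nat q' l') +
  if 0 < eval A (@differ nat q q') + eval A (@differ nat l l')
  then 1 else 0) => //.
rewrite eval_demand_addr addn_gt0 !eval_differ -negb_and if_neg.
by case: ifP => _; rewrite addnC.
Qed.

Definition scaled (q : 'I_n) (l : 'I_m) : nat :=
  eval A (@scaled_demand nat q l).

Lemma eval_beats_term (p q : 'I_n) (j z l l' : 'I_m) :
  (0 < eval A (@beats_term nat p j z q l l')) = beats scaled p j z q l l'.
Proof.
rewrite /beats /scaled -!val_eqE /=.
have := eval_differ l j; have := eval_differ l' j; have := eval_differ l' z.
move=> /= -> -> ->.
case: (_ == _) => /=; first lia.
case: (_ == _) => /=; first lia.
by case: (_ == _) => /=; lia.
Qed.

Lemma eval_not_beaten (p q : 'I_n) (j z l : 'I_m) :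
  (0 < eval A (@not_beaten nat p j z q l)) = ~~ gives_up scaled p j z q l.
Proof.
rewrite lt0n; congr negb.
rewrite [eval _ _](iteri_sum m (fun l' => if 0 < eval A (@differ nat l l')
  then (if 0 < eval A (@beats_term nat p j z q l l') then 0 else 1) else 0)).
rewrite add0n sum_nat_eq0; apply: eq_forallb => l' /=.
rewrite eval_differ eval_beats_term -val_eqE /=.
by case: (val l == val l'); case: (beats _ _ _ _ _ _ _).
Qed.

Lemma eval_allocation_term (p : 'I_n) (j z l : 'I_m) :
  eval A (@allocation_term nat p j z l) = allocation scaled p j z l.
Proof.
rewrite /allocation big_mkcond /= -[RHS]max0n.
transitivity (maxn 0 (\max_(q < n) (if 0 < eval A (@not_beaten nat p j z q l)
  then eval A (@scaled_demand nat q l) else 0))); last first.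
  by congr maxn; apply: eq_bigr => q _; rewrite eval_not_beaten.
rewrite -(iteri_big maxn _ (fun q => if 0 < eval A (@not_beaten nat p j z q l)
  then eval A (@scaled_demand nat q l) else 0)); apply: eq_iteri => q s.
exact: esym (maxnE s _).
Qed.

Lemma eval_total_term (p : 'I_n) (j z : 'I_m) :
  eval A (@total_term nat p j z) = \sum_l allocation scaled p j z l.
Proof.
rewrite [LHS](iteri_sum m (fun l => eval A (@allocation_term nat p j z l))).
by rewrite add0n; apply: eq_bigr => l _; apply: eval_allocation_term.
Qed.

Lemma eval_decision_term : eval A (decision_term nat) != 0 <->
  n = 0 \/ exists (p : 'I_n) (j z : 'I_m),
    \sum_l allocation scaled p j z l <= eval A (common_denom nat).
Proof.
have -> : eval A (decision_term nat) =
  if 0 < n then eval A (search_term nat) else 1 by [].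
case: ifP => [n_gt0|]; last by split=> // _; left; lia.
set D := eval A (common_denom nat).
have -> : eval A (search_term nat) = \sum_(p < n) \sum_(j < m) \sum_(z < m)
    (D + 1 - \sum_l allocation scaled p j z l).
  pose F p j z := D + 1 - eval A (@total_term nat p j z).
  transitivity (\sum_(p < n) \sum_(j < m) \sum_(z < m) F p j z); last first.
    do 3![apply: eq_bigr => ? _]; by rewrite /F eval_total_term.
  rewrite -[RHS]add0n.
  rewrite -(iteri_sum n (fun p => \sum_(j < m) \sum_(z < m) F p j z)).
  apply: eq_iteri => p s.
  rewrite -(iteri_sum m (fun j => \sum_(z < m) F p j z)).
  by apply: eq_iteri => j s'; rewrite -(iteri_sum m (F p j)).
split=> [|[|[p [j [z leD]]]]]; first last.
- rewrite (bigD1 p) //= (bigD1 j) //= (bigD1 z) //=.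
  by rewrite -lt0n !addn_gt0 subn_gt0 addn1 ltnS leD.
- by move=> n0; exfalso; rewrite n0 in n_gt0.
rewrite sum_nat_eq0 => /forallPn[p]; rewrite /= sum_nat_eq0.
move=> /forallPn[j]; rewrite /= sum_nat_eq0 => /forallPn[z].
by rewrite /= => h; right; exists p, j, z; lia.
Qed.

End Eval.

(** * Instances and their encoding *)

Section Encoding.

Variable I : instance.
Notation n := (nb_agents I).
Notation m := (nb_projects I).

Definition fraction_entries : seq (seq nat) :=
  [seq [:: `|numq (demand I i j)|%N; `|denq (demand I i j)|%N]
     | i <- enum 'I_n, j <- enum 'I_m].

Definition instance_entries : seq nat := n :: m :: flatten fraction_entries.

Lemma unary_encodingE : unary_encoding I = flatten (map unary instance_entries).
Proof.
rewrite /unary_encoding /=; congr (_ ++ (_ ++ _)).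
have -> : [seq unary_rat (demand I i j) | i <- enum 'I_n, j <- enum 'I_m] =
    [seq flatten (map unary s) | s <- fraction_entries].
  rewrite map_allpairs; apply: eq_allpairs => i j.
  by rewrite /= cats0.
by elim: fraction_entries => //= s ss ->; rewrite map_cat flatten_cat.
Qed.

Lemma nth_flatten_const (T : Type) (x0 : T) (ss : seq (seq T)) k i j :
    all (fun s => size s == k) ss -> j < k ->
  nth x0 (flatten ss) (i * k + j) = nth x0 (nth [::] ss i) j.
Proof.
elim: ss i => [|s ss IH] i /=; first by rewrite !nth_nil.
move=> /andP[/eqP size_s all_ss] ltj; rewrite nth_cat size_s.
case: i => [|i]; first by rewrite mul0n add0n ltj.
by rewrite mulSn -addnA ltnNge leq_addr addKn IH.
Qed.

Lemma nth_instance_entries (b : bool) (q : 'I_n) (l : 'I_m) :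
  nth 0 instance_entries (2 + b + (q * m + l).*2) =
  (if b then `|denq (demand I q l)| else `|numq (demand I q l)|)%N.
Proof.
have -> : 2 + b + (q * m + l).*2 = ((q * m + l) * 2 + b).+2 by lia.
rewrite /= nth_flatten_const; last by case: b.
  have -> : nth [::] fraction_entries (q * m + l) =
      [:: `|numq (demand I q l)|%N; `|denq (demand I q l)|%N].
    rewrite /fraction_entries /allpairs_dep nth_flatten_const //.
      rewrite (nth_map q) ?size_enum_ord // nth_ord_enum.
      by rewrite (nth_map l) ?size_enum_ord // nth_ord_enum.
    by apply/allP => s /mapP[i _ ->]; rewrite size_map size_enum_ord.
  by case: b.
by apply/allP => s /allpairsP[[i j] [_ _ ->]].
Qed.

Notation A := (nth 0 instance_entries).
Notation D := (eval A (common_denom nat)).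

Lemma common_denomE : D = \prod_(u : 'I_n * 'I_m) `|denq (demand I u.1 u.2)|%N.
Proof.
rewrite eval_common_denom -(pair_bigA _ (fun q l => `|denq (demand I q l)|%N)).
apply: eq_bigr => q _; apply: eq_bigr => l _.
exact: (nth_instance_entries true).
Qed.

Lemma common_denom_gt0 : 0 < D.
Proof.
by rewrite common_denomE prodn_gt0 // => u; rewrite absz_gt0 denq_eq0.
Qed.

Local Open Scope ring_scope.

(** Replacing one denominator in [D] by its numerator multiplies [D] by that demand; the absolute
    value is harmless because demands are nonnegative. *)
Lemma scaledE (q : 'I_n) (l : 'I_m) :
  (@scaled A q l)%:R = demand I q l * D%:R :> rat.
Proof.
rewrite common_denomE /scaled eval_scaled_demand.
set F := fun (i : 'I_n) (j : 'I_m) =>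
  if (q == i) && (l == j) then `|numq (demand I i j)|%N
  else `|denq (demand I i j)|%N.
have -> : (\prod_(i < A 0) \prod_(j < A 1)
    A ((if (q == i :> nat) && (l == j :> nat) then 2 else 3) +
       (i * A 1 + j).*2) = \prod_(u : 'I_n * 'I_m) F u.1 u.2)%N.
  rewrite -(pair_bigA _ F); apply: eq_bigr => i _; apply: eq_bigr => j _.
  rewrite /F -!val_eqE /=; case: ifP => _.
    exact: (nth_instance_entries false).
  exact: (nth_instance_entries true).
rewrite (bigD1 (q, l)) //= [in RHS](bigD1 (q, l)) //= {1}/F !eqxx /=.
rewrite !natrM mulrA; congr (_ * _%:R).
  rewrite -{2}[demand I q l]divq_num_den !natr_absz !ger0_norm ?denq_ge0 //.
    by rewrite divfK // intr_eq0 denq_eq0.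
  by rewrite numq_ge0; case/andP: (demand_itv q l).
apply: eq_bigr => -[i j]; rewrite xpair_eqE /F /= => /negbTE.
by rewrite [i == q]eq_sym [j == l]eq_sym => ->.
Qed.

Lemma sum_scaled : unit_total_demand I ->
  forall q : 'I_n, (\sum_(l < m) @scaled A q l)%N = D.
Proof.
move=> unit_I q; apply/eqP; rewrite -(eqr_nat rat) natr_sum.
by rewrite (eq_bigr _ (fun l _ => scaledE q l)) -mulr_suml unit_I mul1r.
Qed.

(** At least [m.-1] met projects means at most one in the complement. *)
Lemma satisfiedP (R : realType) (x : 'rV[R]_m) (q : 'I_n) :
  satisfied m.-1 x q <->
  forall l l', x 0 l < ratr (demand I q l) -> x 0 l' < ratr (demand I q l') ->
    l = l'.
Proof.
rewrite /satisfied; set S := [set j | _].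
have := cardsC S; rewrite card_ord => cardS.
have -> : (m.-1 <= #|S|)%N = (#|~: S| <= 1)%N by apply/idP/idP; lia.
split=> [/card_le1_eqP S1 l l' ltl ltl'|x_ok].
  by apply: S1; rewrite !inE -ltNge.
apply/card_le1_eqP => l l'; rewrite !inE -!ltNge => ltl ltl'.
  exact: x_ok.
Qed.

Lemma all_agents_satP (R : realType) :
  all_agents_sat R m.-1 I <->
  exists x, feasible (@scaled A : 'I_n -> 'I_m -> nat) D x.
Proof.
have D_gt0 : 0 < D%:R :> R by rewrite ltr0n common_denom_gt0.
have scaledR q l : (@scaled A q l)%:R = ratr (demand I q l) * D%:R :> R.
  by rewrite -[LHS](ratr_nat R) scaledE rmorphM /= ratr_nat.
split=> [[x [x_itv x_bud x_sat]]|[y [leD y_ok]]].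
  (* Round [x] down to the largest scaled demand that it meets: the cost does not grow and no met
     demand is lost. *)
  pose y l := (\max_(q < n | (ratr (demand I q l) <= x 0 l)%R) @scaled A q l)%N.
  have le_y l : (y l)%:R <= x 0 l * D%:R.
    apply: (big_ind (fun k : nat => k%:R <= x 0 l * D%:R)).
    - by rewrite mulr_ge0 ?ler0n //; case/andP: (x_itv l).
    - by move=> u v leu lev; rewrite /maxn; case: ifP.
    - by move=> q; rewrite scaledR ler_pM2r.
  exists y; split.
    rewrite -(ler_nat R) natr_sum.
    apply: le_trans (ler_sum _ (fun l _ => le_y l)) _.
    by rewrite -mulr_suml ler_piMl ?ler0n.
  have lt_y q l : (y l < @scaled A q l)%N -> x 0 l < ratr (demand I q l).
    rewrite ltnNge ltNge; apply: contra => h.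
    exact: (@leq_bigmax_cond _ (fun q => ratr (demand I q l) <= x 0 l)
      (fun q => scaled q l)) h.
  move=> q l l' /lt_y ltl /lt_y ltl'.
  exact: (proj1 (satisfiedP x q) (x_sat q)).
have leyD l : (y l <= D)%N.
  by apply: leq_trans leD; rewrite (bigD1 l) //= leq_addr.
(* Conversely divide by [D]; each [y l] is at most [D], so the entries stay in the unit interval. *)
exists (\row_l ((y l)%:R / D%:R)); split.
- move=> l; rewrite mxE divr_ge0 ?ler0n //= ler_pdivrMr // mul1r ler_nat //.
- rewrite /budget_feasible (eq_bigr (fun l => (y l)%:R / D%:R)) => [|l _];
    last by rewrite mxE.
  by rewrite -mulr_suml ler_pdivrMr // mul1r -natr_sum ler_nat.
move=> q; apply/satisfiedP => l l'.
rewrite !mxE !ltr_pdivrMr // -!scaledR !ltr_nat.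
exact: y_ok.
Qed.

End Encoding.

Theorem theorem5 (R : realType) :
  pseudopoly_time_decidable
    unit_total_demand
    (fun I : instance => all_agents_sat R (nb_projects I).-1 I).
Proof.
apply: (poly_time_decidable_term related_decision_term unary_encodingE).
move=> I unit_I.
rewrite eval_decision_term all_agents_satP.
have sumD := sum_scaled unit_I; have D_gt0 := common_denom_gt0 I.
split=> [[n0|]|].
- exists (fun=> 0); split=> [|q]; first by rewrite big1.
  by have := ltn_ord q; rewrite [X in _ < X](n0 : nb_agents I = 0).
- move=> [p [j [z leD]]].
  apply: (proj2 (feasible_iff sumD D_gt0 _)); last by exists p, j, z.
  by rewrite card_ord (leq_ltn_trans (leq0n p) (ltn_ord p)).
move=> feas; have [n0|n_gt0] := posnP (nb_agents I); first by left.
by right; apply: (proj1 (feasible_iff sumD D_gt0 _)); rewrite ?card_ord.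
Qed.
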